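(* For any finite poset $(T,\preceq)$, $T=\{1,\dots,t\}$, the problem of classifying pairs of matrices up to simultaneous similarity contains the problem of classifying representations of $(T,\preceq)$.
   Context: Matrices are over a field $k$. A representation of the poset $(T,\preceq)$ is a block matrix $[A_1\,|\,A_2\,|\cdots|\,A_t]$ (all blocks having the same number of rows, arbitrary numbers of columns); two representations are isomorphic if one reduces to the other by (a) elementary row transformations of the whole matrix, (b) elementary column transformations within each vertical strip $A_i$, (c) additions of a column of $A_i$ to a column of $A_j$ whenever $i\prec j$. The pair problem: pairs $(M,N)$ of $n\times n$ matrices ($n$ arbitrary) up to simultaneous similarity $(M,N)\mapsto(S^{-1}MS,S^{-1}NS)$. A matrix problem $\mathcal A$ is given by a set $\mathcal A_1$ of $a$-tuples of matrices and a set of admissible transformations (''$A$ reduces to $A'$''). $\mathcal B$ contains $\mathcal A$ if there is a $b$-tuple $\mathcal T(x_1,\dots,x_a)$ of matrices whose entries are noncommutative polynomials in $x_1,\dots,x_a$ (substitution $x_i\mapsto A_i$ done blockwise, scalars $c$ becoming $cI$, $0$ becoming zero blocks) such that (i) $\mathcal T(A)\in\mathcal B_1$ for every $A\in\mathcal A_1$, and (ii) for all $A,A'\in\mathcal A_1$, $A$ reduces to $A'$ in $\mathcal A$ iff $\mathcal T(A)$ reduces to $\mathcal T(A')$ in $\mathcal B$. *)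

(* Defs.v *)
From HB Require Import structures.
From mathcomp Require Import all_boot all_order all_algebra.
From Stdlib Require Import Relations.
Set Implicit Arguments. Unset Strict Implicit. Unset Printing Implicit Defensive.
Import GRing.Theory.
Local Open Scope ring_scope.

(* Representations of a poset (T, ⪯), T = 'I_t ({1..t} shifted to 0..t-1). *)
(* A representation is a block matrix [A_1 | ... | A_t]: m rows, and  *)
(* the i-th vertical strip A_i has n_i columns.                        *)
Record prep (k : fieldType) (t : nat) := Prep {
  pr_m : nat;
  pr_n : 'I_t -> nat;
  pr_A : forall i : 'I_t, 'M[k]_(pr_m, pr_n i) }.
Arguments pr_m {k t} R : rename.
Arguments pr_n {k t} R i : rename.
Arguments pr_A {k t} R i : rename.

Definition plt (t : nat) (le : rel 'I_t) (i j : 'I_t) : bool :=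
  le i j && (i != j).

Inductive prep_step (k : fieldType) (t : nat) (le : rel 'I_t) :
    prep k t -> prep k t -> Prop :=
| PS_row (m : nat) (n : 'I_t -> nat) (A : forall i, 'M[k]_(m, n i))
    (S : 'M[k]_m) :
    S \in unitmx ->
    prep_step le (@Prep k t m n A) (@Prep k t m n (fun i => S *m A i))
| PS_col (m : nat) (n : 'I_t -> nat) (A : forall i, 'M[k]_(m, n i))
    (C : forall i, 'M[k]_(n i)) :
    (forall i, C i \in unitmx) ->
    prep_step le (@Prep k t m n A) (@Prep k t m n (fun i => A i *m C i))
| PS_add (m : nat) (n : 'I_t -> nat) (A : forall i, 'M[k]_(m, n i))
    (X : forall i j, 'M[k]_(n i, n j)) :
    prep_step le (@Prep k t m n A)
      (@Prep k t m n (fun j => A j + \sum_(i | plt le i j) A i *m X i j)).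

Definition prep_red (k : fieldType) (t : nat) (le : rel 'I_t) :
  relation (prep k t) := clos_refl_trans _ (@prep_step k t le).

Record mpair (k : fieldType) := MPair {
  mp_n : nat; mp_M : 'M[k]_mp_n; mp_N : 'M[k]_mp_n }.
Arguments mp_n {k} P : rename.

Inductive pair_red (k : fieldType) : mpair k -> mpair k -> Prop :=
| PairRed (n : nat) (M N S : 'M[k]_n) :
    S \in unitmx ->
    pair_red (@MPair k n M N)
             (@MPair k n (invmx S *m M *m S) (invmx S *m N *m S)).

(* Noncommutative polynomials in the variables x_1..x_t (one variable per
   strip A_i), written as formal sums of scalar multiples of words. *)
Definition ncpoly (k : fieldType) (t : nat) := seq (k * seq 'I_t).

(* Block labels: a block row/column of T has size equal to one of the
   dimension parameters of the substituted tuple: label 0 <-> m,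
   label i.+1 <-> n_i. *)
Definition pdim (k : fieldType) (t : nat) (R : prep k t) (l : 'I_t.+1) : nat :=
  if unlift ord0 l is Some i then pr_n R i else pr_m R.

(* Variable x_i is substituted by A_i, of size m x n_i, i.e. goes from
   label 0 to label (lift ord0 i). A word is well typed between labels a
   and b when the blockwise product makes sense (the empty word = scalar
   c becoming c I requires a = b). *)
Fixpoint word_typed (t : nat) (w : seq 'I_t) (a b : 'I_t.+1) : bool :=
  match w with
  | [::] => a == b
  | i :: w' => (a == ord0) && word_typed w' (lift ord0 i) b
  end.

Fixpoint eval_word (k : fieldType) (t : nat) (R : prep k t) (w : seq 'I_t)
    (a b : 'I_t.+1) : 'M[k]_(pdim R a, pdim R b) :=
  match w with
  | [::] => conform_mx 0 (1%:M : 'M[k]_(pdim R a))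
  | i :: w' => conform_mx 0 (pr_A R i) *m eval_word R w' (lift ord0 i) b
  end.

Definition eval_ncpoly (k : fieldType) (t : nat) (R : prep k t)
    (P : ncpoly k t) (a b : 'I_t.+1) : 'M[k]_(pdim R a, pdim R b) :=
  \sum_(cw <- P) cw.1 *: eval_word R cw.2 a b.

Record bpmx (k : fieldType) (t : nat) := BPmx {
  bp_p : nat; bp_q : nat;
  bp_r : 'I_bp_p -> 'I_t.+1;
  bp_c : 'I_bp_q -> 'I_t.+1;
  bp_E : 'I_bp_p -> 'I_bp_q -> ncpoly k t }.
Arguments bp_p {k t} B : rename.
Arguments bp_q {k t} B : rename.
Arguments bp_r {k t} B r : rename.
Arguments bp_c {k t} B c : rename.
Arguments bp_E {k t} B r c : rename.

Definition bp_typed (k : fieldType) (t : nat) (B : bpmx k t) : bool :=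
  [forall r, forall c,
     all (fun cw : k * seq 'I_t => word_typed cw.2 (bp_r B r) (bp_c B c))
         (bp_E B r c)].

Definition bp_rows (k : fieldType) (t : nat) (B : bpmx k t) (R : prep k t) :=
  (\sum_(r < bp_p B) pdim R (bp_r B r))%N.
Definition bp_cols (k : fieldType) (t : nat) (B : bpmx k t) (R : prep k t) :=
  (\sum_(c < bp_q B) pdim R (bp_c B c))%N.

Definition bp_eval (k : fieldType) (t : nat) (B : bpmx k t) (R : prep k t) :
    'M[k]_(bp_rows B R, bp_cols B R) :=
  @mxblock k _ _ (fun r => pdim R (bp_r B r)) (fun c => pdim R (bp_c B c))
    (fun r c => eval_ncpoly R (bp_E B r c) (bp_r B r) (bp_c B c)).

(* T(A) as a pair of square matrices of size bp_rows T.1 (the casts are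
   identities whenever condition (i) below holds). *)
Definition T_pair (k : fieldType) (t : nat) (T : bpmx k t * bpmx k t)
    (R : prep k t) : mpair k :=
  @MPair k (bp_rows T.1 R)
    (conform_mx 0 (bp_eval T.1 R)) (conform_mx 0 (bp_eval T.2 R)).

Definition pair_contains_poset (k : fieldType) (t : nat) (le : rel 'I_t) : Prop :=
  exists T : bpmx k t * bpmx k t,
    (* (i) T(A) is a well-defined pair of square matrices of equal size *)
    [/\ bp_typed T.1, bp_typed T.2 &
        forall R : prep k t,
          [/\ bp_cols T.1 R = bp_rows T.1 R,
              bp_rows T.2 R = bp_rows T.1 R &
              bp_cols T.2 R = bp_rows T.1 R]] /\
    (forall R R' : prep k t, prep_red le R R' <-> pair_red (T_pair T R) (T_pair T R')).

(* Main.v *)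
(* A representation is encoded by one matrix A acting on the sum U of all row
   and column spaces, the rows being labelled by an extra point incomparable to
   T.  Isomorphisms become invertible X with A X = X A' that preserve, for every
   label v, the image of the projection F_v onto the summands of label >= v;
   the latter means that F_v X = Y_v F'_v for some Y_v.  So one needs a pair
   (M, N) on several copies of U whose intertwiners are block diagonal, made of
   X and of one independent Y_v for each v.  On t+2 layers of t+2 copies of U,
   let M be the shift of layers.  Commuting with M makes an intertwiner block
   Toeplitz and triangular; a single identity block in the last row of N forces
   it to be diag(Y, ..., Y); the first row of N carries idempotents, which make
   Y block diagonal over the copies of U, and a slot with A and the F_v.  No
   distinct eigenvalues are used, so any field will do. *)
Require Import Defs.
From Stdlib Require Import Relations FunctionalExtensionality.
From mathcomp Require Import all_boot all_order all_algebra.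
Set Implicit Arguments. Unset Strict Implicit. Unset Printing Implicit
  Defensive.
Import GRing.Theory.
Local Open Scope ring_scope.

Lemma sum_one (V : nmodType) (I : finType) (F : I -> V) z :
  (forall x, x != z -> F x = 0) -> \sum_x F x = F z.
Proof. by move=> F0; rewrite (bigD1 z) //= big1 ?addr0. Qed.

(** * Inclusions of summands *)

Section BlockInclusion.
Variables (k : fieldType) (p : nat) (d : 'I_p -> nat).

(** Row vectors are the convention throughout: right multiplication by [incl i] embeds the [i]-th
    summand, and its transpose projects onto it. *)
Definition incl (i : 'I_p) : 'M[k]_(d i, \sum_j d j) := submxcol 1%:M i.

Lemma tr_incl i : (incl i)^T = submxrow 1%:M i.
Proof. by rewrite /incl tr_submxcol trmx1. Qed.

Lemma incl_mxblock (B : forall i j, 'M[k]_(d i, d j)) i j :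
  incl i *m (\mxblock_(r, c) B r c) *m (incl j)^T = B i j.
Proof.
rewrite tr_incl mul_submxrow mulmx1 /incl submxcol_mul mul1mx -submxblockEv.
by rewrite mxblockK.
Qed.

Lemma mul_incl i j : incl i *m (incl j)^T = submxblock 1%:M i j.
Proof. by rewrite tr_incl mul_submxrow mulmx1 -submxblockEv. Qed.

Lemma inclK i : incl i *m (incl i)^T = 1%:M.
Proof.
rewrite mul_incl; apply/matrixP => a b.
by rewrite !mxE -val_eqE /= tagnat.eq_Rank eqxx.
Qed.

Lemma incl_ortho i j : i != j -> incl i *m (incl j)^T = 0.
Proof.
move=> ij; rewrite mul_incl; apply/matrixP => a b.
by rewrite !mxE -val_eqE /= tagnat.eq_Rank (negPf ij).
Qed.

Lemma sum_incl : \sum_i (incl i)^T *m incl i = 1%:M.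
Proof.
rewrite -[RHS]mul1mx -{2}(submxcolK 1%:M) -{1}(submxrowK 1%:M) mul_mxrow_mxcol.
by apply: eq_bigr => i _; rewrite tr_incl.
Qed.

End BlockInclusion.
Arguments incl {k p} d i.

(** * Transport between equal dimensions *)

Section Transport.
Variable k : fieldType.

(* Transport along n = m; the value is 0 when n <> m. *)
Definition cast1 (n m : nat) : 'M[k]_(n, m) := conform_mx 0 (1%:M : 'M_n).

Lemma cast1_id n : cast1 n n = 1%:M.
Proof. by rewrite /cast1 conform_mx_id. Qed.

Lemma cast1K n m : n = m -> cast1 n m *m (cast1 n m)^T = 1%:M.
Proof. by move=> <-; rewrite cast1_id trmx1 mulmx1. Qed.

Lemma tr_cast1K n m : n = m -> (cast1 n m)^T *m cast1 n m = 1%:M.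
Proof. by move=> <-; rewrite cast1_id trmx1 mulmx1. Qed.

Lemma conform_cast1 n m n' m' (A : 'M[k]_(n, m)) : n = n' -> m = m' ->
  conform_mx 0 A = (cast1 n n')^T *m A *m cast1 m m'.
Proof.
by move=> <- <-; rewrite conform_mx_id !cast1_id trmx1 mul1mx mulmx1.
Qed.

End Transport.
Arguments cast1 {k} n m.

(** * The space of a representation, its matrix and its projections *)

Section Representation.
Variables (k : fieldType) (t : nat) (le : rel 'I_t).
Implicit Types (R : prep k t) (l v : 'I_t.+1) (i j : 'I_t).

Lemma pdim0 R : pdim R ord0 = pr_m R.
Proof. by rewrite /pdim unlift_none. Qed.

Lemma pdimS R i : pdim R (lift ord0 i) = pr_n R i.
Proof. by rewrite /pdim liftK. Qed.

Definition tdim R : nat := (\sum_l pdim R l)%N.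

Definition label_incl R l : 'M[k]_(pdim R l, tdim R) := incl (pdim R) l.

Lemma label_inclK R l : label_incl R l *m (label_incl R l)^T = 1%:M.
Proof. exact: inclK. Qed.

Lemma label_ortho R l l' :
  l != l' -> label_incl R l *m (label_incl R l')^T = 0.
Proof. exact: incl_ortho. Qed.

Lemma sum_label_incl R : \sum_l (label_incl R l)^T *m label_incl R l = 1%:M.
Proof. exact: sum_incl. Qed.

(** [cast1] passes from [pr_m R] to [pdim R ord0], equal by [pdim0], so that products with
    [pr_A R i] are typed; [locked] keeps the cast folded in later rewriting. *)
Definition row_incl R : 'M[k]_(pr_m R, tdim R) :=
  locked (cast1 _ _ *m label_incl R ord0).

Definition strip_incl R i : 'M[k]_(pr_n R i, tdim R) :=
  locked (cast1 _ _ *m label_incl R (lift ord0 i)).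

Lemma row_inclE R : row_incl R = cast1 _ _ *m label_incl R ord0.
Proof. by rewrite /row_incl -lock. Qed.

Lemma strip_inclE R i :
  strip_incl R i = cast1 _ _ *m label_incl R (lift ord0 i).
Proof. by rewrite /strip_incl -lock. Qed.

Lemma row_inclK R : row_incl R *m (row_incl R)^T = 1%:M.
Proof.
by rewrite ?row_inclE ?strip_inclE trmx_mul mulmxA -(mulmxA (cast1 _ _))
  label_inclK mulmx1 cast1K ?pdim0.
Qed.

Lemma strip_inclK R i : strip_incl R i *m (strip_incl R i)^T = 1%:M.
Proof.
by rewrite ?row_inclE ?strip_inclE trmx_mul mulmxA -(mulmxA (cast1 _ _))
  label_inclK mulmx1 cast1K ?pdimS.
Qed.

Lemma row_strip_ortho R i : row_incl R *m (strip_incl R i)^T = 0.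
Proof.
by rewrite ?row_inclE ?strip_inclE trmx_mul mulmxA -(mulmxA (cast1 _ _))
  label_ortho // mulmx0 mul0mx.
Qed.

Lemma strip_row_ortho R i : strip_incl R i *m (row_incl R)^T = 0.
Proof.
by rewrite ?row_inclE ?strip_inclE trmx_mul mulmxA -(mulmxA (cast1 _ _))
  label_ortho // mulmx0 mul0mx.
Qed.

Lemma strip_ortho R i j : i != j -> strip_incl R i *m (strip_incl R j)^T = 0.
Proof.
move=> ij; rewrite ?row_inclE ?strip_inclE trmx_mul mulmxA -(mulmxA (cast1 _
  _)) label_ortho //.
by rewrite mulmx0 mul0mx.
Qed.

Lemma tr_row_inclK R :
  (row_incl R)^T *m row_incl R = (label_incl R ord0)^T *m label_incl R ord0.
Proof.
by rewrite ?row_inclE ?strip_inclE trmx_mul mulmxA -(mulmxA (label_incl _ _)^T)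
  tr_cast1K ?mulmx1 ?pdim0.
Qed.

Lemma tr_strip_inclK R i : (strip_incl R i)^T *m strip_incl R i =
  (label_incl R (lift ord0 i))^T *m label_incl R (lift ord0 i).
Proof.
by rewrite ?row_inclE ?strip_inclE trmx_mul mulmxA -(mulmxA (label_incl _ _)^T)
  tr_cast1K ?mulmx1 ?pdimS.
Qed.

Lemma sum_row_strip R : (row_incl R)^T *m row_incl R +
  \sum_i (strip_incl R i)^T *m strip_incl R i = 1%:M.
Proof.
rewrite -[RHS]sum_label_incl big_ord_recl tr_row_inclK; congr (_ + _).
by apply: eq_bigr => i _; rewrite tr_strip_inclK.
Qed.

Definition rep_mx R : 'M[k]_(tdim R) :=
  \sum_i (row_incl R)^T *m pr_A R i *m strip_incl R i.

(* The order of T extended by an extra element, incomparable to the others,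
   standing for the rows. *)
Definition leo l l' : bool :=
  match unlift ord0 l, unlift ord0 l' with
  | Some i, Some j => le i j
  | None, None => true
  | _, _ => false
  end.

Lemma leo00 : leo ord0 ord0.
Proof. by rewrite /leo unlift_none. Qed.

Lemma leo0S i : leo ord0 (lift ord0 i) = false.
Proof. by rewrite /leo unlift_none liftK. Qed.

Lemma leoS0 i : leo (lift ord0 i) ord0 = false.
Proof. by rewrite /leo unlift_none liftK. Qed.

Lemma leoSS i j : leo (lift ord0 i) (lift ord0 j) = le i j.
Proof. by rewrite /leo !liftK. Qed.

Definition filt R v : 'M[k]_(tdim R) :=
  \sum_(l | leo v l) (label_incl R l)^T *m label_incl R l.

Lemma label_filt R v l :
  label_incl R l *m filt R v = (leo v l)%:R *: label_incl R l.
Proof.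
rewrite /filt mulmx_sumr; case: (boolP (leo v l)) => vl.
  rewrite (bigD1 l) //= mulmxA label_inclK mul1mx scale1r big1 ?addr0 // => l'
    /andP[_ ll'].
  by rewrite mulmxA label_ortho ?mul0mx // eq_sym.
rewrite scale0r big1 // => l' vl'; rewrite mulmxA label_ortho ?mul0mx //.
by apply: contraNneq vl => ->.
Qed.

Lemma row_filt R v : row_incl R *m filt R v = (leo v ord0)%:R *: row_incl R.
Proof. by rewrite ?row_inclE ?strip_inclE -mulmxA label_filt scalemxAr. Qed.

Lemma strip_filt R v i :
  strip_incl R i *m filt R v = (leo v (lift ord0 i))%:R *: strip_incl R i.
Proof. by rewrite ?row_inclE ?strip_inclE -mulmxA label_filt scalemxAr. Qed.

Lemma tr_filt R v : (filt R v)^T = filt R v.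
Proof.
by rewrite /filt linear_sum; apply: eq_bigr => l _ /=; rewrite trmx_mul trmxK.
Qed.

Lemma filt_id R v : filt R v *m filt R v = filt R v.
Proof.
rewrite {1}/filt mulmx_suml; apply: eq_bigr => l vl.
by rewrite ?row_inclE ?strip_inclE -mulmxA label_filt vl scale1r.
Qed.

Lemma filt_row R v :
  filt R v *m (row_incl R)^T = (leo v ord0)%:R *: (row_incl R)^T.
Proof. by rewrite -{1}tr_filt -trmx_mul row_filt linearZ. Qed.

Lemma filt_strip R v i : filt R v *m (strip_incl R i)^T =
  (leo v (lift ord0 i))%:R *: (strip_incl R i)^T.
Proof. by rewrite -{1}tr_filt -trmx_mul strip_filt linearZ. Qed.

(** One alphabet with two readings, as matrices on the whole space and as polynomials between
    labels, so that the pair can be handled as a table of symbols. *)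
Variant bsym := Zero | One | Filt of 'I_t.+1 | Rep.

Definition sym_mx R (s : bsym) : 'M[k]_(tdim R) :=
  match s with
  | Zero => 0
  | One => 1%:M
  | Filt v => filt R v
  | Rep => rep_mx R
  end.

Definition sym_poly (s : bsym) l l' : ncpoly k t :=
  match s with
  | Zero => [::]
  | One => if l == l' then [:: (1, [::])] else [::]
  | Filt v => if (l == l') && leo v l then [:: (1, [::])] else [::]
  | Rep => if unlift ord0 l' is Some i then
             if l == ord0 then [:: (1, [:: i])] else [::]
           else [::]
  end.

Lemma sym_poly_typed s l l' :
  all (fun cw : k * seq 'I_t => word_typed cw.2 l l') (sym_poly s l l').
Proof.
case: s => [||v|] //=.
- by case: eqP => //= ->; rewrite eqxx.
- by case: eqP => //= ->; case: ifP => //= _; rewrite eqxx.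
case: unliftP => [i ->|] //; case: eqP => //= ->; by rewrite !eqxx.
Qed.

(** For [One] and [Filt v] only pairs of equal labels contribute, by constant polynomials; for [Rep]
    only the pairs from the row label to a strip do, each through the one-letter word of its
    [A_i]. *)
Lemma sum_sym_poly R s :
  \sum_l \sum_l' (label_incl R l)^T *m eval_ncpoly R (sym_poly s l l') l l'
     *m label_incl R l' = sym_mx R s.
Proof.
have ev0 l l' : eval_ncpoly R [::] l l' = 0 by rewrite /eval_ncpoly big_nil.
have ev1 l : eval_ncpoly R [:: (1, [::])] l l = 1%:M.
  by rewrite /eval_ncpoly big_seq1 /= scale1r conform_mx_id.
case: s => [||v|] /=.
- by rewrite big1 // => l _; rewrite big1 // => l' _; rewrite ev0 mulmx0 mul0mx.
- rewrite -[RHS]sum_label_incl; apply: eq_bigr => l _.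
  rewrite (bigD1 l) //= big1 ?addr0 ?eqxx ?ev1 ?mulmx1 // => l'.
  by rewrite eq_sym => /negPf->; rewrite ev0 mulmx0 mul0mx.
- rewrite /filt [RHS]big_mkcond; apply: eq_bigr => l _.
  rewrite (bigD1 l) //= big1 ?addr0 ?eqxx /=; last first.
    by move=> l'; rewrite eq_sym => /negPf->; rewrite ev0 mulmx0 mul0mx.
  by case: ifP => _; rewrite ?ev1 ?mulmx1 ?ev0 ?mulmx0 ?mul0mx.
rewrite big_ord_recl [X in _ + X]big1 ?addr0; last first.
  move=> i _; rewrite big1 // => l' _; case: unliftP => [j _|_] /=;
  by rewrite ?ev0 ?mulmx0 ?mul0mx // -(inj_eq (@ord_inj _)) /= ev0 mulmx0
    mul0mx.
rewrite big_ord_recl unlift_none ev0 mulmx0 mul0mx add0r.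
apply: eq_bigr => i _; rewrite liftK eqxx /eval_ncpoly big_seq1 scale1r /=.
rewrite conform_mx_id mulmx1 (conform_cast1 _ (esym (pdim0 R)) (esym (pdimS R
  i))).
by rewrite row_inclE strip_inclE trmx_mul !mulmxA.
Qed.

(** * Isomorphisms of representations *)

(** In terms of row vectors, [X] sends the image of [filt R v] into the image of [filt R' v]. *)
Definition preserves R R' (X : 'M[k]_(tdim R, tdim R')) : Prop :=
  forall v, filt R v *m X *m (1%:M - filt R' v) = 0.

Lemma preservesE R R' (X : 'M[k]_(tdim R, tdim R')) v :
  preserves X -> filt R v *m X = filt R v *m X *m filt R' v.
Proof.
by move=> /(_ v) /eqP; rewrite mulmxBr mulmx1 subr_eq0 => /eqP.
Qed.

Lemma preserves_mul R R' R'' (X : 'M[k]_(tdim R, tdim R'))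
    (Y : 'M[k]_(tdim R', tdim R'')) :
  preserves X -> preserves Y -> preserves (X *m Y).
Proof.
move=> pX pY v; rewrite mulmxA (preservesE _ pX) -2!mulmxA.
by rewrite [filt R' v *m _]mulmxA (pY v) mulmx0.
Qed.

Lemma preserves1 R : preserves (1%:M : 'M_(tdim R)).
Proof. by move=> v; rewrite mulmx1 mulmxBr mulmx1 filt_id subrr. Qed.

Lemma preserves0 R R' : preserves (0 : 'M_(tdim R, tdim R')).
Proof. by move=> v; rewrite mulmx0 mul0mx. Qed.

Lemma preservesD R R' (X Y : 'M[k]_(tdim R, tdim R')) :
  preserves X -> preserves Y -> preserves (X + Y).
Proof. by move=> pX pY v; rewrite [filt R v *m _]mulmxDr mulmxDl pX pY addr0.
  Qed.

Lemma preservesN R R' (X : 'M[k]_(tdim R, tdim R')) :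
  preserves X -> preserves (- X).
Proof. by move=> pX v; rewrite mulmxN mulNmx pX oppr0. Qed.

Lemma preserves_sum R R' (I : finType) (P : pred I)
    (X : I -> 'M[k]_(tdim R, tdim R')) :
  (forall a, P a -> preserves (X a)) -> preserves (\sum_(a | P a) X a).
Proof.
move=> pX; elim/big_ind: _ => //; [exact: preserves0 | exact: preservesD].
Qed.

Lemma preserves_row R R' (S : 'M[k]_(pr_m R, pr_m R')) :
  preserves ((row_incl R)^T *m S *m row_incl R').
Proof.
move=> v; rewrite !mulmxA filt_row -mulmxA mulmxBr mulmx1 row_filt.
case: (leo _ _); first by rewrite !scale1r subrr mulmx0.
by rewrite scale0r !mul0mx.
Qed.

Hypothesis le_trans : transitive le.

(** By transitivity, if [filt R v] retains strip [i], then [filt R' v] retains strip [j]. *)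
Lemma preserves_strip R R' i j (C : 'M[k]_(pr_n R i, pr_n R' j)) :
  le i j -> preserves ((strip_incl R i)^T *m C *m strip_incl R' j).
Proof.
move=> ij v; rewrite !mulmxA filt_strip -mulmxA mulmxBr mulmx1 strip_filt.
have : leo v (lift ord0 i) -> leo v (lift ord0 j).
  case: (unliftP ord0 v) => [w|] ->; last by rewrite leo0S.
  by rewrite !leoSS => /le_trans; apply.
case: (leo v (lift ord0 i)); last by rewrite scale0r !mul0mx.
by move=> ->//; rewrite !scale1r subrr mulmx0.
Qed.

Hypothesis le_refl : reflexive le.

(** Apply the condition at the label of strip [i]: reflexivity puts that strip in the filtered part,
    while the row label lies outside it. *)
Lemma preserves_strip_row R R' i (X : 'M[k]_(tdim R, tdim R')) :
  preserves X -> strip_incl R i *m X *m (row_incl R')^T = 0.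
Proof.
move=> /(_ (lift ord0 i)) /(congr1 (fun Y => strip_incl R i *m Y *m (row_incl
  R')^T)).
rewrite mulmx0 mul0mx !mulmxA strip_filt leoSS le_refl scale1r -!mulmxA.
by rewrite mulmxBl mul1mx filt_row leoS0 scale0r subr0.
Qed.

Lemma preserves_row_strip R R' i (X : 'M[k]_(tdim R, tdim R')) :
  preserves X -> row_incl R *m X *m (strip_incl R' i)^T = 0.
Proof.
move=> /(_ ord0) /(congr1 (fun Y => row_incl R *m Y *m (strip_incl R' i)^T)).
rewrite mulmx0 mul0mx !mulmxA row_filt leo00 scale1r -!mulmxA.
by rewrite mulmxBl mul1mx filt_strip leo0S scale0r subr0.
Qed.

Lemma preserves_strip_strip R R' i j (X : 'M[k]_(tdim R, tdim R')) :
  ~~ le i j -> preserves X -> strip_incl R i *m X *m (strip_incl R' j)^T = 0.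
Proof.
move=> /negPf nij /(_ (lift ord0 i)).
move=> /(congr1 (fun Y => strip_incl R i *m Y *m (strip_incl R' j)^T)).
rewrite mulmx0 mul0mx !mulmxA strip_filt leoSS le_refl scale1r -!mulmxA.
by rewrite mulmxBl mul1mx filt_strip leoSS nij scale0r subr0.
Qed.

Lemma insert1 R n1 n2 (X : 'M[k]_(n1, tdim R)) (Y : 'M[k]_(tdim R, n2)) :
  X *m Y = X *m (row_incl R)^T *m (row_incl R *m Y) +
    \sum_i X *m (strip_incl R i)^T *m (strip_incl R i *m Y).
Proof.
have -> : X *m Y = X *m 1%:M *m Y by rewrite mulmx1.
rewrite -(sum_row_strip R) mulmxDr mulmxDl mulmx_sumr mulmx_suml !mulmxA.
by congr (_ + _); apply: eq_bigr => i _; rewrite !mulmxA.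
Qed.

Hypothesis le_anti : antisymmetric le.

(** Expand over the summands in the middle. For strip [i], a term through strip [j] survives only if
    [i] precedes [j] and [j] precedes [i], hence only for [j = i] by antisymmetry. *)
Lemma preserves_diag R R' (X : 'M[k]_(tdim R, tdim R')) X' :
  X *m X' = 1%:M -> preserves X -> preserves X' ->
  (row_incl R *m X *m (row_incl R')^T) *m (row_incl R' *m X' *m (row_incl R)^T)
    = 1%:M
  /\ forall i, (strip_incl R i *m X *m (strip_incl R' i)^T) *m
    (strip_incl R' i *m X' *m (strip_incl R i)^T) = 1%:M.
Proof.
move=> XX' pX pX'; split=> [|i].
  have H : (row_incl R *m X) *m (X' *m (row_incl R)^T) = 1%:M.
    by rewrite mulmxA -(mulmxA _ X) XX' mulmx1 row_inclK.
  rewrite -H [RHS](insert1 (R := R')) [X in _ + X]big1 ?addr0 ?mulmxA // => i _.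
  by rewrite preserves_row_strip // mul0mx.
have H : (strip_incl R i *m X) *m (X' *m (strip_incl R i)^T) = 1%:M.
  by rewrite mulmxA -(mulmxA _ X) XX' mulmx1 strip_inclK.
rewrite -H [RHS](insert1 (R := R')) preserves_strip_row // mul0mx add0r.
rewrite (bigD1 i) //= [X in _ + X]big1 ?addr0 ?mulmxA // => j ji.
have [ij|nij] := boolP (le i j); last by rewrite preserves_strip_strip ?mul0mx.
rewrite [strip_incl R' j *m (_ *m _)]mulmxA [strip_incl R' j *m _ *m
  _]preserves_strip_strip ?mulmx0 //.
by apply: contraNN ji => le_ji; apply/eqP/le_anti; rewrite le_ji.
Qed.

(** The dimensions of [R] and [R'] may differ a priori, so isomorphisms compose without casts;
    equality follows in [prep_iso_dims]. *)
Definition prep_iso R R' : Prop :=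
  exists X X', [/\ X *m X' = 1%:M, X' *m X = 1%:M,
    rep_mx R *m X = X *m rep_mx R', @preserves R R' X & preserves X'].

Lemma prep_iso_refl R : prep_iso R R.
Proof.
exists 1%:M, 1%:M; split; rewrite ?mul1mx ?mulmx1 //; exact: preserves1.
Qed.

Lemma prep_iso_trans R R' R'' : prep_iso R R' -> prep_iso R' R'' -> prep_iso R
  R''.
Proof.
move=> [X] [X'] [XX' X'X AX pX pX'] [Y] [Y'] [YY' Y'Y AY pY pY'].
exists (X *m Y), (Y' *m X'); split; try exact: preserves_mul.
- by rewrite mulmxA -(mulmxA X) YY' mulmx1.
- by rewrite mulmxA -(mulmxA Y') X'X mulmx1.
by rewrite mulmxA AX -!mulmxA AY.
Qed.

Definition diag_asm R R' (S : 'M[k]_(pr_m R, pr_m R'))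
    (C : forall i, 'M[k]_(pr_n R i, pr_n R' i)) : 'M[k]_(tdim R, tdim R') :=
  (row_incl R)^T *m S *m row_incl R' +
  \sum_i (strip_incl R i)^T *m C i *m strip_incl R' i.

Lemma row_diag_asm R R' S C :
  row_incl R *m @diag_asm R R' S C = S *m row_incl R'.
Proof.
rewrite mulmxDr !mulmxA row_inclK mul1mx mulmx_sumr big1 ?addr0 // => i _.
by rewrite !mulmxA row_strip_ortho !mul0mx.
Qed.

Lemma strip_diag_asm R R' S C i :
  strip_incl R i *m @diag_asm R R' S C = C i *m strip_incl R' i.
Proof.
rewrite mulmxDr !mulmxA strip_row_ortho !mul0mx add0r mulmx_sumr (bigD1 i) //=.
rewrite !mulmxA strip_inclK mul1mx big1 ?addr0 // => j ji.
by rewrite !mulmxA strip_ortho ?mul0mx // eq_sym.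
Qed.

Lemma diag_asm_mul R R' R'' S C S' C' :
  @diag_asm R R' S C *m @diag_asm R' R'' S' C' =
  diag_asm (S *m S') (fun i => C i *m C' i).
Proof.
rewrite {1}/diag_asm mulmxDl -!mulmxA row_diag_asm !mulmxA; congr (_ + _).
  by rewrite !mulmxA.
rewrite mulmx_suml; apply: eq_bigr => i _.
by rewrite -!mulmxA strip_diag_asm !mulmxA.
Qed.

Lemma diag_asm1 R : @diag_asm R R 1%:M (fun=> 1%:M) = 1%:M.
Proof.
rewrite -[RHS]sum_row_strip /diag_asm mulmx1; congr (_ + _).
by apply: eq_bigr => i _; rewrite mulmx1.
Qed.

Lemma diag_asm_preserves R R' S C : preserves (@diag_asm R R' S C).
Proof.
apply: preservesD; first exact: preserves_row.
by apply: preserves_sum => i _; apply: preserves_strip.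
Qed.

Lemma row_rep_mx R : row_incl R *m rep_mx R = \sum_i pr_A R i *m strip_incl R i.
Proof.
rewrite mulmx_sumr; apply: eq_bigr => i _.
by rewrite !mulmxA row_inclK mul1mx.
Qed.

Lemma strip_rep_mx R i : strip_incl R i *m rep_mx R = 0.
Proof.
rewrite mulmx_sumr big1 // => j _.
by rewrite !mulmxA strip_row_ortho !mul0mx.
Qed.

Lemma rep_mx_row R : rep_mx R *m (row_incl R)^T = 0.
Proof.
rewrite mulmx_suml big1 // => j _.
by rewrite -!mulmxA strip_row_ortho !mulmx0.
Qed.

Lemma rep_mx_strip R i :
  rep_mx R *m (strip_incl R i)^T = (row_incl R)^T *m pr_A R i.
Proof.
rewrite mulmx_suml (bigD1 i) //= big1 => [|j ji].
  by rewrite -!mulmxA strip_inclK mulmx1 addr0.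
by rewrite -!mulmxA strip_ortho // !mulmx0.
Qed.

(** Serves row and column transformations alike: the last hypothesis is the intertwining relation on
    the blocks from the rows to the strips, outside which both sides vanish. *)
Lemma prep_iso_diag R R' (S : 'M[k]_(pr_m R, pr_m R')) S'
    (C : forall i, 'M[k]_(pr_n R i, pr_n R' i)) C' :
  S *m S' = 1%:M -> S' *m S = 1%:M ->
  (forall i, C i *m C' i = 1%:M) -> (forall i, C' i *m C i = 1%:M) ->
  (forall i, S *m pr_A R' i = pr_A R i *m C i) -> prep_iso R R'.
Proof.
move=> SS' S'S CC' C'C SA; exists (diag_asm S C), (diag_asm S' C').
split; try exact: diag_asm_preserves.
- rewrite diag_asm_mul SS' -[RHS]diag_asm1; congr (_ + _).
  by apply: eq_bigr => i _; rewrite CC'.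
- rewrite diag_asm_mul S'S -[RHS]diag_asm1; congr (_ + _).
  by apply: eq_bigr => i _; rewrite C'C.
rewrite /diag_asm mulmxDl mulmx_suml [X in _ = _ + X]big1 ?addr0 => [|i _];
  last first.
  by rewrite -mulmxA strip_rep_mx mulmx0.
rewrite -(mulmxA _ (row_incl R')) row_rep_mx mulmx_sumr mulmxDr !mulmxA
  rep_mx_row !mul0mx add0r.
rewrite mulmx_sumr; apply: eq_bigr => i _.
by rewrite !mulmxA rep_mx_strip -!mulmxA [S *m _]mulmxA SA !mulmxA.
Qed.

(** * Additions between strips as unipotent matrices *)

Definition height i : nat := #|[pred j | plt le j i]|.

Lemma plt_trans i j (l : 'I_t) : plt le i j -> plt le j l -> plt le i l.
Proof.
case/andP=> ij nij /andP[jl njl]; rewrite /plt (le_trans ij jl) /=.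
by apply: contraNN nij => /eqP il; apply/eqP/le_anti; rewrite ij /= il.
Qed.

Lemma height_lt i j : plt le i j -> (height i < height j)%N.
Proof.
move=> ij; apply/proper_card/properP; split.
  by apply/subsetP=> l; rewrite !inE => /plt_trans; apply.
by exists i; rewrite !inE // /plt eqxx andbF.
Qed.

Lemma height_max i : (height i < t)%N.
Proof.
rewrite -[X in (_ < X)%N]card_ord; apply/proper_card/properP; split.
  exact/subsetP.
by exists i; rewrite // !inE /plt eqxx andbF.
Qed.

Section Addition.
Variables (R : prep k t) (C : forall i j, 'M[k]_(pr_n R i, pr_n R j)).

Definition add_asm : 'M[k]_(tdim R) :=
  \sum_i \sum_(j | plt le i j) (strip_incl R i)^T *m C i j *m strip_incl R j.

Lemma row_add_asm : row_incl R *m add_asm = 0.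
Proof.
rewrite mulmx_sumr big1 // => i _; rewrite mulmx_sumr big1 // => j _.
by rewrite !mulmxA row_strip_ortho !mul0mx.
Qed.

Lemma strip_add_asm i :
  strip_incl R i *m add_asm = \sum_(j | plt le i j) C i j *m strip_incl R j.
Proof.
rewrite mulmx_sumr (bigD1 i) //= [X in _ + X]big1 ?addr0 => [|l li].
  rewrite mulmx_sumr; apply: eq_bigr => j _.
  by rewrite !mulmxA strip_inclK mul1mx.
rewrite mulmx_sumr big1 // => j _.
by rewrite !mulmxA strip_ortho ?mul0mx // eq_sym.
Qed.

Lemma add_asm_nilpotent : add_asm ^+ t.+1 = 0.
Proof.
(* Each factor moves to strips of strictly greater height, and heights stay below [t], so a product
   started at strip [i] dies after [t - height i] factors. *)
have strip0 q i : (t <= height i + q)%N -> strip_incl R i *m (add_asm ^+ q) = 0.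
  elim: q i => [|q IHq] i; first by rewrite addn0 leqNgt height_max.
  rewrite exprS -mulmxE mulmxA strip_add_asm mulmx_suml => ti.
  rewrite big1 // => j ij; rewrite -mulmxA IHq ?mulmx0 //.
  by rewrite (leq_trans ti) // addnS -addSn leq_add2r height_lt.
rewrite -[LHS]mul1mx -(sum_row_strip R) mulmxDl mulmx_suml big1 => [|i _].
  by rewrite exprS -mulmxE !mulmxA -(mulmxA _ (row_incl R)) row_add_asm mulmx0
    mul0mx addr0.
by rewrite -mulmxA strip0 ?mulmx0 // addnS ltnW // ltnS leq_addl.
Qed.

Lemma add_asm_preserves : preserves add_asm.
Proof.
apply: preserves_sum => i _; apply: preserves_sum => j /andP[ij _].
exact: preserves_strip.
Qed.

(** The geometric series for the inverse of [1%:M + add_asm], finite by nilpotency. Being a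
    polynomial in [add_asm], it preserves the filtration. *)
Definition add_inv : 'M[k]_(tdim R) := \sum_(q < t.+1) (- add_asm) ^+ q.

Lemma add_invK : (1%:M + add_asm) *m add_inv = 1%:M.
Proof.
(* [subrX1] factors [(- add_asm) ^+ t.+1 - 1]; the power vanishes, and a change of sign on both
   sides gives the claim. *)
have := subrX1 (- add_asm) t.+1; rewrite exprNn add_asm_nilpotent mulr0 sub0r.
rewrite -[1 in X in _ = X]opprK -opprD mulNr => /oppr_inj.
by rewrite opprK addrC => H; rewrite [RHS]H.
Qed.

Lemma add_inv_preserves : preserves add_inv.
Proof.
apply: preserves_sum => q _; elim: {q}(q : nat) => [|q IHq].
  exact: preserves1.
by rewrite exprS; apply: preserves_mul => //;
  apply/preservesN/add_asm_preserves.
Qed.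

Lemma rep_mx_add : rep_mx R *m add_asm =
  \sum_j (row_incl R)^T *m (\sum_(i | plt le i j) pr_A R i *m C i j) *m
    strip_incl R j.
Proof.
rewrite mulmx_suml.
under eq_bigr => i _ do rewrite -mulmxA strip_add_asm mulmx_sumr.
rewrite (exchange_big_dep xpredT) //=; apply: eq_bigr => j _.
rewrite mulmx_sumr mulmx_suml; apply: eq_bigr => i _.
by rewrite !mulmxA.
Qed.

End Addition.

Lemma prep_step_iso R R' : prep_step le R R' -> prep_iso R R'.
Proof.
case=> [m n A S uS|m n A C uC|m n A X].
(* An intertwiner satisfies [A X = X A'], so the row transformation [S] enters through its
   inverse. *)
- apply: (@prep_iso_diag (Prep A) (Prep (fun i => S *m A i))
    (invmx S) S (fun=> 1%:M) (fun=> 1%:M)); rewrite /= ?mulVmx ?mulmxV // => i;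
    rewrite ?mulmx1 // mulKmx //.
- apply: (@prep_iso_diag (Prep A) (Prep (fun i => A i *m C i))
    1%:M 1%:M C (fun i => invmx (C i))); rewrite /= ?mulmx1 // => i;
    by rewrite ?mulmxV ?mulVmx ?mul1mx.
set R1 := Prep A; set R2 := Prep _.
pose N : 'M_(tdim R1) := @add_asm R1 X.
(* [R1] and [R2] have the same dimensions by conversion, so matrices on [R1] may be read as maps
   between the two. *)
exists (1%:M + N : 'M_(tdim R1, tdim R2)), (@add_inv R1 X : 'M_(tdim R2, tdim
  R1)).
have pN : preserves N := @add_asm_preserves R1 X.
have VK : (1%:M + N) *m @add_inv R1 X = 1%:M := @add_invK R1 X.
split.
- exact: VK.
- exact: (mulmx1C VK).
(* The new matrix is [A (1 + N)]. It equals [(1 + N) A (1 + N)] because [N A = 0]: [N] lands in the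
   strips, where the rows of [A] are zero. *)
- have -> : rep_mx R2 = rep_mx R1 + rep_mx R1 *m N.
    rewrite rep_mx_add -big_split /=; apply: eq_bigr => j _.
    by rewrite -mulmxDl -mulmxDr.
  rewrite mulmxDr mulmx1 mulmxDl mul1mx mulmxDr mulmxA.
  suff -> : N *m rep_mx R1 = 0 by rewrite mul0mx !addr0.
  rewrite mulmx_suml big1 // => i _; rewrite mulmx_suml big1 // => j _.
  by rewrite -mulmxA strip_rep_mx mulmx0.
- exact: (preservesD (preserves1 R1) pN).
exact: (@add_inv_preserves R1 X).
Qed.

(** * From isomorphisms back to reductions *)

Lemma prep_iso_dims R R' :
  prep_iso R R' -> pr_m R = pr_m R' /\ pr_n R = pr_n R'.
Proof.
move=> [X] [X'] [XX' X'X _ pX pX'].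
have [r s] := preserves_diag XX' pX pX'.
have [r' s'] := preserves_diag X'X pX' pX.
split; last apply: functional_extensionality => i; apply/eqP.
  by rewrite eqn_leq (mulmx1_min r) (mulmx1_min r').
by rewrite eqn_leq (mulmx1_min (s i)) (mulmx1_min (s' i)).
Qed.

(** The isomorphism is factored into column transformations by its diagonal blocks on the strips,
    additions from its off-diagonal blocks, and a row transformation by the inverse of its block on
    the rows. *)
Lemma prep_iso_red R R' : prep_iso R R' -> prep_red le R R'.
Proof.
move=> isoRR'; have [] := prep_iso_dims isoRR'.
case: R R' isoRR' => m n A [m' n' A'] /= iso em en.
move: A' iso; case: m' / em; case: n' / en => A'.
set R := Prep A; set R' := Prep A' => -[X] [X'] [XX' X'X AX pX pX'].
have [rX sX] := preserves_diag XX' pX pX'.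
pose S : 'M_m := row_incl R *m X *m (row_incl R')^T.
pose C i j : 'M_(n i, n j) := strip_incl R i *m X *m (strip_incl R' j)^T.
have uS : S \in unitmx by have [] := mulmx1_unit rX.
have uC i : C i i \in unitmx by have [] := mulmx1_unit (sX i).
have C0 i j : ~~ le i j -> C i j = 0 by move=> nij; exact:
  (@preserves_strip_strip R R' i j X nij pX).
have eA j : S *m A' j = \sum_i A i *m C i j.
  have := congr1 (fun Y => row_incl R *m Y *m (strip_incl R' j)^T) AX.
  rewrite !mulmxA row_rep_mx -(mulmxA _ (rep_mx R')) rep_mx_strip mulmxA => <-.
  rewrite !mulmx_suml; apply: eq_bigr => i _; by rewrite /C !mulmxA.
(* The strips are rescaled by [C i i] before the additions, so the coefficients [D i j] undo that
   factor. *)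
pose B i := A i *m C i i; pose D i j := invmx (C i i) *m C i j.
have eB j : B j + \sum_(i | plt le i j) B i *m D i j = S *m A' j.
  rewrite eA [RHS](bigD1 j) //=; congr (_ + _); rewrite [RHS](bigID (le^~ j))
    /=.
  rewrite [X in _ = _ + X]big1 ?addr0 => [|i /andP[_ nij]]; last by rewrite C0
    ?mulmx0.
  apply: eq_big => [i|i _]; first by rewrite /plt andbC.
  by rewrite /B /D -mulmxA mulKVmx.
apply: rt_trans (rt_step _ _ _ _ (PS_col le A uC)) _.
apply: rt_trans (rt_step _ _ _ _ (PS_add le B D)) _.
apply: rt_step; have uV : invmx S \in unitmx by rewrite unitmx_inv.
have := PS_row le (fun j => B j + \sum_(i | plt le i j) B i *m D i j) uV.
congr prep_step; congr Prep; apply: functional_extensionality_dep => j.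
by rewrite eB mulKmx.
Qed.

Lemma prep_redP R R' : prep_red le R R' <-> prep_iso R R'.
Proof.
split; last exact: prep_iso_red.
elim=> [R1 R2|R1|R1 R2 R3 _ i12 _ i23]; first exact: prep_step_iso.
  exact: prep_iso_refl.
exact: prep_iso_trans i12 i23.
Qed.

(** * Polynomial matrices made of blocks indexed by a finite type *)

Section BlowUp.
Variable K : finType.
Notation idx := 'I_#|{: K * 'I_t.+1}|.

Definition key (r : idx) : K := (enum_val r).1.
Definition lab (r : idx) : 'I_t.+1 := (enum_val r).2.

(** A block of a polynomial matrix has one label per side, so each key, standing for a whole copy of
    the space, is split into one index per label. *)
Definition blow (E : K -> K -> bsym) : bpmx k t :=
  @BPmx k t _ _ lab lab
    (fun r c => sym_poly (E (key r) (key c)) (lab r) (lab c)).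

Lemma blow_typed E : bp_typed (blow E).
Proof. by apply/forallP => r; apply/forallP => c; apply: sym_poly_typed. Qed.

Definition bdim R : nat := (\sum_r pdim R (lab r))%N.

Definition blow_mx E R : 'M[k]_(bdim R) := bp_eval (blow E) R.

Definition idx_incl R r : 'M[k]_(pdim R (lab r), bdim R) :=
  incl (fun r => pdim R (lab r)) r.

Definition key_incl R x : 'M[k]_(tdim R, bdim R) :=
  \sum_(r | key r == x) (label_incl R (lab r))^T *m idx_incl R r.

Lemma sum_key (V : nmodType) (F : 'I_t.+1 -> V) x :
  \sum_(r | key r == x) F (lab r) = \sum_l F l.
Proof.
rewrite (reindex_onto (fun l => enum_rank (x, l)) lab) /key /lab => [|r /eqP
  <-].
  by apply: eq_big => [l|l _]; rewrite enum_rankK ?eqxx.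
by rewrite -surjective_pairing enum_valK.
Qed.

Lemma key_lab_inj r r' : key r = key r' -> lab r = lab r' -> r = r'.
Proof.
rewrite /key /lab => ek el; apply: enum_val_inj.
by rewrite [LHS]surjective_pairing ek el -surjective_pairing.
Qed.

Lemma idx_inclK R r : idx_incl R r *m (idx_incl R r)^T = 1%:M.
Proof. exact: (@inclK k _ (fun r => pdim R (lab r)) r). Qed.

Lemma idx_ortho R r r' : r != r' -> idx_incl R r *m (idx_incl R r')^T = 0.
Proof. exact: (@incl_ortho k _ (fun r => pdim R (lab r)) r r'). Qed.

Lemma sum_idx_incl R : \sum_r (idx_incl R r)^T *m idx_incl R r = 1%:M.
Proof. exact: (@sum_incl k _ (fun r => pdim R (lab r))). Qed.

Lemma idx_incl_blow E R r c : idx_incl R r *m blow_mx E R *m (idx_incl R c)^T =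
  eval_ncpoly R (sym_poly (E (key r) (key c)) (lab r) (lab c)) (lab r) (lab c).
Proof.
exact: (@incl_mxblock k _ (fun r => pdim R (lab r)) (fun r c => eval_ncpoly R _
  _ _)).
Qed.

Lemma key_idx R x r : key_incl R x *m (idx_incl R r)^T =
  if key r == x then (label_incl R (lab r))^T else 0.
Proof.
rewrite mulmx_suml; case: ifP => rx.
  rewrite (bigD1 r) //= -mulmxA idx_inclK mulmx1 big1 ?addr0 // => r' /andP[_
    rr'].
  by rewrite -mulmxA idx_ortho // mulmx0.
rewrite big1 // => r' r'x; rewrite -mulmxA idx_ortho ?mulmx0 //.
by apply: contraFneq rx => <-.
Qed.

Lemma key_inclE R x : (key_incl R x)^T =
  \sum_(r | key r == x) (idx_incl R r)^T *m label_incl R (lab r).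
Proof.
by rewrite linear_sum; apply: eq_bigr => r _ /=; rewrite trmx_mul trmxK.
Qed.

Lemma key_inclK R x : key_incl R x *m (key_incl R x)^T = 1%:M.
Proof.
rewrite key_inclE mulmx_sumr -sum_label_incl -(sum_key _ x).
by apply: eq_bigr => r rx; rewrite mulmxA key_idx rx.
Qed.

Lemma key_ortho R x y : x != y -> key_incl R x *m (key_incl R y)^T = 0.
Proof.
move=> xy; rewrite key_inclE mulmx_sumr big1 // => r /eqP ry.
by rewrite mulmxA key_idx ry eq_sym (negPf xy) mul0mx.
Qed.

Lemma sum_key_incl R : \sum_x (key_incl R x)^T *m key_incl R x = 1%:M.
Proof.
rewrite -sum_idx_incl [RHS](partition_big key xpredT) //=.
apply: eq_bigr => x _; rewrite key_inclE mulmx_suml; apply: eq_bigr => r rx.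
rewrite mulmx_sumr (bigD1 r) //= big1 ?addr0 => [|r' /andP[r'x rr']].
  by rewrite mulmxA -(mulmxA _ (label_incl R _)) label_inclK mulmx1.
rewrite mulmxA -(mulmxA _ (label_incl R _)) label_ortho ?mulmx0 ?mul0mx //.
apply: contraNneq rr' => el; apply/eqP/key_lab_inj => //.
by rewrite (eqP rx) (eqP r'x).
Qed.

Lemma key_blow E R x y :
  key_incl R x *m blow_mx E R *m (key_incl R y)^T = sym_mx R (E x y).
Proof.
rewrite -sum_sym_poly key_inclE mulmx_sumr -(sum_key _ x).
under [RHS]eq_bigr => r _ do rewrite -(sum_key _ y).
rewrite exchange_big /=; apply: eq_bigr => c /eqP cy.
rewrite /key_incl !mulmx_suml; apply: eq_bigr => r /eqP rx.
rewrite mulmxA -(mulmxA _ (idx_incl R r)) -(mulmxA _ (idx_incl R r *m _)).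
by rewrite idx_incl_blow rx cy.
Qed.

Lemma key_ext R R' (A B : 'M[k]_(bdim R, bdim R')) :
  (forall x y, key_incl R x *m A *m (key_incl R' y)^T =
     key_incl R x *m B *m (key_incl R' y)^T) -> A = B.
Proof.
move=> AB; rewrite -[A]mul1mx -[B]mul1mx -sum_key_incl !mulmx_suml.
apply: eq_bigr => x _; rewrite -!mulmxA; congr (_ *m _).
rewrite -[LHS]mulmx1 -[RHS]mulmx1 -(sum_key_incl R') !mulmx_sumr.
by apply: eq_bigr => y _; rewrite !mulmxA AB.
Qed.

Section Blocks.
Variables (R R' : prep k t) (S : 'M[k]_(bdim R, bdim R')).

Definition block x y : 'M[k]_(tdim R, tdim R') :=
  key_incl R x *m S *m (key_incl R' y)^T.

Lemma block_mull E x y :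
  key_incl R x *m (blow_mx E R *m S) *m (key_incl R' y)^T =
  \sum_z sym_mx R (E x z) *m block z y.
Proof.
rewrite -[S]mul1mx -sum_key_incl mulmx_suml !mulmx_sumr mulmx_suml.
by apply: eq_bigr => z _; rewrite /block -key_blow !mulmxA.
Qed.

Lemma block_mulr E x y :
  key_incl R x *m (S *m blow_mx E R') *m (key_incl R' y)^T =
  \sum_z block x z *m sym_mx R' (E z y).
Proof.
rewrite -[S]mulmx1 -sum_key_incl mulmx_sumr mulmx_suml mulmx_sumr mulmx_suml.
by apply: eq_bigr => z _; rewrite /block -key_blow !mulmxA.
Qed.

End Blocks.

Lemma block_mul R R' (S : 'M[k]_(bdim R, bdim R')) S' x y :
  S *m S' = 1%:M ->
  \sum_z block S x z *m block S' z y = if x == y then 1%:M else 0.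
Proof.
move=> SS'; transitivity (key_incl R x *m (S *m S') *m (key_incl R y)^T).
  rewrite -[S in RHS]mulmx1 -sum_key_incl mulmx_sumr mulmx_suml mulmx_sumr
    mulmx_suml.
  by apply: eq_bigr => z _; rewrite /block !mulmxA.
rewrite SS' mulmx1; case: eqVneq => [->|xy]; first exact: key_inclK.
exact: key_ortho.
Qed.

Section BlockDiagonal.
Variables (R R' : prep k t) (Y : K -> 'M[k]_(tdim R, tdim R')).

Definition key_diag : 'M[k]_(bdim R, bdim R') :=
  \sum_x (key_incl R x)^T *m Y x *m key_incl R' x.

Lemma key_diag_row x : key_incl R x *m key_diag = Y x *m key_incl R' x.
Proof.
rewrite mulmx_sumr (bigD1 x) //= big1 ?addr0 => [|y yx].
  by rewrite !mulmxA key_inclK mul1mx.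
by rewrite !mulmxA key_ortho ?mul0mx // eq_sym.
Qed.

Lemma key_diag_col x : key_diag *m (key_incl R' x)^T = (key_incl R x)^T *m Y x.
Proof.
rewrite mulmx_suml (bigD1 x) //= big1 ?addr0 => [|y yx].
  by rewrite -!mulmxA key_inclK mulmx1.
by rewrite -!mulmxA key_ortho // !mulmx0.
Qed.

Lemma key_diag_intertwines E :
  (forall x y, sym_mx R (E x y) *m Y y = Y x *m sym_mx R' (E x y)) ->
  blow_mx E R *m key_diag = key_diag *m blow_mx E R'.
Proof.
move=> EY; apply: key_ext => x y.
rewrite [in RHS]mulmxA key_diag_row -!mulmxA key_diag_col !mulmxA key_blow EY.
by rewrite -key_blow !mulmxA.
Qed.

End BlockDiagonal.

Lemma key_diagK R R' Y Y' :
  (forall x, Y x *m Y' x = 1%:M) -> @key_diag R R' Y *m @key_diag R' R Y' =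
    1%:M.
Proof.
move=> YY'; rewrite -sum_key_incl mulmx_suml; apply: eq_bigr => x _.
by rewrite -!mulmxA key_diag_row !mulmxA -(mulmxA _ (Y x)) YY' mulmx1.
Qed.

End BlowUp.

(** Stated with intertwiners so that the sizes need not agree in advance; a two-sided inverse forces
    them to. *)
Lemma pair_redP (P P' : mpair k) : pair_red P P' <->
  exists S S', [/\ S *m S' = 1%:M, S' *m S = 1%:M,
    mp_M P *m S = S *m mp_M P' & mp_N P *m S = S *m mp_N P'].
Proof.
split=> [[n M N S uS]|].
  by exists S, (invmx S); rewrite /= mulmxV // mulVmx // -!mulmxA !mulKVmx.
case: P P' => n M N [n' M' N'] /= [S] [S'] [SS' S'S MS NS].
have en : n = n'.
  by apply/eqP; rewrite eqn_leq (mulmx1_min SS') (mulmx1_min S'S).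
case: n' / en M' N' S S' SS' S'S MS NS => M' N' S S' SS' _ MS NS.
have [uS _] := mulmx1_unit SS'.
by have := PairRed M N uS; rewrite -!mulmxA MS NS !mulKmx.
Qed.

(** * The pair (M, N) *)

(* A block index is a pair (layer, copy of U); copy [ord0] is the one carrying
   the matrix of the representation, copy [lift ord0 v] receives F_v. *)
Notation big_idx := ('I_t.+2 * 'I_t.+2)%type.
Implicit Types (p q a b : 'I_t.+2).

Definition sym_M (x y : big_idx) : bsym :=
  if (y.1 == x.1.+1 :> nat) && (x.2 == y.2) then One else Zero.

(** Only column [ord0] is filled, so that for a block diagonal [Y] each entry ties the diagonal
    block of its own row to the one on copy [ord0]. *)
Definition sym_Z a b : bsym :=
  if b == ord0 then (if unlift ord0 a is Some v then Filt v else Rep) else Zero.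

(** Layers and copies share an index type, so that the first layer row can hold, at each layer [q]
    other than [ord0], the idempotent of copy [q]. *)
Definition sym_N (x y : big_idx) : bsym :=
  if x.1 == ord0 then
    if y.1 == ord0 then sym_Z x.2 y.2
    else if (x.2 == y.1) && (y.2 == y.1) then One else Zero
  else if [&& x.1 == ord_max, y.1 == ord0 & x.2 == y.2] then One else Zero.

Lemma filt_compl R v : filt R v *m (1%:M - filt R v) = 0.
Proof. by rewrite mulmxBr mulmx1 filt_id subrr. Qed.

Lemma compl_filt R v : (1%:M - filt R v) *m filt R v = 0.
Proof. by rewrite mulmxBl mul1mx filt_id subrr. Qed.

(** * Intertwiners are block diagonal *)

Section Forward.
Variables (R R' : prep k t) (S : 'M[k]_(bdim big_idx R, bdim big_idx R')).
Hypothesis SM : blow_mx sym_M R *m S = S *m blow_mx sym_M R'.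
Hypothesis SN : blow_mx sym_N R *m S = S *m blow_mx sym_N R'.

Let s p a q b := block S (p, a) (q, b).

Lemma blocksM x y : \sum_z sym_mx R (sym_M x z) *m block S z y =
  \sum_z block S x z *m sym_mx R' (sym_M z y).
Proof. by rewrite -block_mull SM block_mulr. Qed.

Lemma blocksN x y : \sum_z sym_mx R (sym_N x z) *m block S z y =
  \sum_z block S x z *m sym_mx R' (sym_N z y).
Proof. by rewrite -block_mull SN block_mulr. Qed.

Lemma sum_symM_l p p' a y : p' = p.+1 :> nat ->
  \sum_z sym_mx R (sym_M (p, a) z) *m block S z y = block S (p', a) y.
Proof.
move=> pp'; rewrite (@sum_one _ _ _ (p', a)) => [|[q b] nz].
  by rewrite /sym_M /= pp' !eqxx mul1mx.
rewrite /sym_M /= -pp' val_eqE; case: andP => [[/eqP eq /eqP eb]|_]; last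
  exact: mul0mx.
by rewrite eq eb eqxx in nz.
Qed.

Lemma sum_symM_r q q' b x : q = q'.+1 :> nat ->
  \sum_z block S x z *m sym_mx R' (sym_M z (q, b)) = block S x (q', b).
Proof.
move=> qq'; rewrite (@sum_one _ _ _ (q', b)) => [|[p a] nz].
  by rewrite /sym_M /= qq' !eqxx mulmx1.
rewrite /sym_M /= qq' eqSS val_eqE; case: andP => [[/eqP eq /eqP eb]|_]; last
  exact: mulmx0.
by rewrite eq eb eqxx in nz.
Qed.

(** Toeplitz property: the two sides are the blocks of [M S] and [S M'] at layers [p] and [q']. *)
Lemma s_shift p p' a q q' b : p' = p.+1 :> nat -> q' = q.+1 :> nat ->
  s p' a q' b = s p a q b.
Proof.
by move=> ep eq; rewrite /s -(sum_symM_l _ _ ep) blocksM (sum_symM_r _ _ eq).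
Qed.

(** No layer precedes [ord0], so column layer [ord0] of [S M'] is zero, while in [M S] it is that of
    [S] moved up by one layer. *)
Lemma s_col0 p a b : p != ord0 -> s p a ord0 b = 0.
Proof.
case: p => [[|p] lep] // _; have lp : (p < t.+2)%N by exact: ltnW.
rewrite /s -(@sum_symM_l (Ordinal lp)) // blocksM big1 // => -[q c] _.
by rewrite /sym_M /= mulmx0.
Qed.

(** By the identity block, the last layer row of [N S] is the first one of [S]. In [S N'], layer [q]
    is reached only from the first layer row of [N'], which meets blocks killed by [s_col0]. *)
Lemma s_row0 a q b : q != ord0 -> s ord0 a q b = 0.
Proof.
move=> q0; rewrite /s; have := blocksN (ord_max, a) (q, b).
rewrite (@sum_one _ _ _ (ord0, a)) => [|[p c] nz]; last first.
  rewrite /sym_N /= eqxx /=; case: andP => [[/eqP ep /eqP ec]|_]; last exact: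
    mul0mx.
  by rewrite ep ec eqxx in nz.
rewrite /sym_N /= !eqxx mul1mx => ->; rewrite big1 // => -[p c] _ /=.
case: eqVneq => [->|_]; last by rewrite (negPf q0) andbF mulmx0.
by rewrite [block _ _ _]s_col0 ?mul0mx.
Qed.

(** Moving back along a diagonal ends in the corner, or in a block of the first layer row or column
    that vanishes. *)
Lemma s_diag p a q b : s p a q b = if p == q then s ord0 a ord0 b else 0.
Proof.
case: p => p; elim: p a q b => [|p IHp] a q b lep.
  have -> : Ordinal lep = ord0 by apply: val_inj.
  case: eqVneq => [q0|q0]; first by rewrite -q0.
  by rewrite s_row0 // eq_sym.
case: q => [[|q] leq].
  by have -> : Ordinal leq = ord0; [apply: val_inj | rewrite s_col0].
by rewrite (@s_shift (Ordinal (ltnW lep)) _ _ (Ordinal (ltnW leq))) // IHp.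
Qed.

Let Y a b := s ord0 a ord0 b.

(** With [S] equal to [diag(Y, ..., Y)], each block of the first layer row of [N] yields its own
    intertwining relation for [Y]. *)
Lemma Y_sym a b q :
  \sum_c sym_mx R (sym_N (ord0, a) (q, c)) *m Y c b =
  \sum_c Y a c *m sym_mx R' (sym_N (ord0, c) (q, b)).
Proof.
have sumK (V : nmodType) (F : big_idx -> V) p :
    (forall x, x.1 != p -> F x = 0) -> \sum_x F x = \sum_c F (p, c).
  move=> F0; rewrite (eq_bigr (fun x => F (x.1, x.2))) => [|[] //].
  rewrite -(pair_bigA _ (fun p c => F (p, c))) /=.
  by apply: sum_one => p' np; rewrite big1 // => c _; apply: F0.
have := blocksN (ord0, a) (q, b); rewrite (sumK _ _ q) => [|[p c] /= np]; last
  first.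
  by rewrite [block _ _ _]s_diag (negPf np) mulmx0.
rewrite [RHS](sumK _ _ ord0) => [|[p c] /= np]; last first.
  by rewrite [block _ _ _]s_diag eq_sym (negPf np) mul0mx.
move=> E; rewrite -[RHS]E; apply: eq_bigr => c _.
by rewrite [block _ _ _]s_diag eqxx.
Qed.

(** [Y] commutes with the idempotents of all copies other than [ord0]; of two distinct copies at
    least one is such. *)
Lemma Y_diag a b : a != b -> Y a b = 0.
Proof.
have main q : q != ord0 ->
    (if a == q then Y q b else 0) = (if b == q then Y a q else 0).
  move=> q0; have := Y_sym a b q; rewrite /sym_N /= (negPf q0).
  rewrite (@sum_one _ _ _ q) => [|c /negPf->]; last by rewrite andbF mul0mx.
  rewrite (@sum_one _ _ _ q) => [|c /negPf->]; last by rewrite mulmx0.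
  rewrite eqxx andbT /= [b == q]eq_sym.
  by do 2!case: ifP => _; rewrite /= ?mul1mx ?mulmx1 ?mul0mx ?mulmx0.
move=> ab; have [a0|a0] := eqVneq a ord0.
  have b0 : b != ord0 by rewrite -a0 eq_sym.
  by have := main b b0; rewrite eqxx (negPf ab).
by have := main a a0; rewrite eqxx eq_sym (negPf ab).
Qed.

Lemma Y_Z a : sym_mx R (sym_Z a ord0) *m Y ord0 ord0 =
  Y a a *m sym_mx R' (sym_Z a ord0).
Proof.
have := Y_sym a ord0 ord0; rewrite /sym_N /=.
rewrite (@sum_one _ _ _ ord0) => [|c c0]; last by rewrite Y_diag ?mulmx0.
by rewrite (@sum_one _ _ _ a) => // c ca; rewrite Y_diag ?mul0mx // eq_sym.
Qed.

Lemma Y_rep : rep_mx R *m Y ord0 ord0 = Y ord0 ord0 *m rep_mx R'.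
Proof. by have := Y_Z ord0; rewrite /sym_Z unlift_none. Qed.

(** The slot gives [F_v X = Y_v F'_v], and [1 - F'_v] kills the right side. *)
Lemma Y_preserves : preserves (Y ord0 ord0).
Proof.
move=> v; have := Y_Z (lift ord0 v); rewrite /sym_Z liftK /= => ->.
by rewrite -(mulmxA _ (filt R' v)) filt_compl mulmx0.
Qed.

Lemma block_row0 x : x != (ord0, ord0) -> block S (ord0, ord0) x = 0.
Proof.
case: x => q b nx; rewrite [LHS]s_diag; case: eqVneq => // q0.
apply: Y_diag; rewrite eq_sym; apply: contraNneq nx => ->; by rewrite -q0.
Qed.

End Forward.

(** * The two directions of the equivalence *)

(** The corner blocks of [S] and [S'] form the isomorphism; they are mutually inverse since the rest
    of the corner block row vanishes. *)
Lemma iso_of_blow R R' (S : 'M[k]_(bdim big_idx R, bdim big_idx R')) S' :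
  S *m S' = 1%:M -> S' *m S = 1%:M ->
  blow_mx sym_M R *m S = S *m blow_mx sym_M R' ->
  blow_mx sym_N R *m S = S *m blow_mx sym_N R' -> prep_iso R R'.
Proof.
move=> SS' S'S SM SN.
have swap (E : big_idx -> big_idx -> bsym) : blow_mx E R *m S = S *m blow_mx E
  R' ->
    blow_mx E R' *m S' = S' *m blow_mx E R.
  move=> ES; rewrite -[LHS]mul1mx -S'S -!mulmxA; congr (_ *m _).
  by rewrite mulmxA -ES -mulmxA SS' mulmx1.
have [SM' SN'] := (swap _ SM, swap _ SN).
have unit R1 R2 (T : 'M[k]_(bdim big_idx R1, bdim big_idx R2)) T' : T *m T' =
  1%:M ->
    blow_mx sym_M R1 *m T = T *m blow_mx sym_M R2 ->
    blow_mx sym_N R1 *m T = T *m blow_mx sym_N R2 ->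
    block T (ord0, ord0) (ord0, ord0) *m block T' (ord0, ord0) (ord0, ord0) =
      1%:M.
  move=> TT' TM TN; have := block_mul (ord0, ord0) (ord0, ord0) TT'.
  rewrite eqxx (@sum_one _ _ _ (ord0, ord0)) // => x x0.
  by rewrite (block_row0 TM TN x0) mul0mx.
exists (block S (ord0, ord0) (ord0, ord0)), (block S' (ord0, ord0) (ord0,
  ord0)).
split; [exact: unit | exact: unit | exact: Y_rep | exact: Y_preserves | exact:
  Y_preserves].
Qed.

(* The diagonal block of the intertwiner on copy a; for a = lift ord0 v it is a
   solution Y_v of F_v X = Y_v F'_v, made invertible on the complement. *)
Definition spread R R' (X : 'M[k]_(tdim R, tdim R')) a : 'M[k]_(tdim R, tdim
  R') :=
  if unlift ord0 a is Some v then
    filt R v *m X *m filt R' v + (1%:M - filt R v) *m X *m (1%:M - filt R' v)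
  else X.

(** With respect to the projections, [X] and [X'] are block triangular and [spread] keeps the
    diagonal blocks; those of mutually inverse triangular matrices are mutually inverse. *)
Lemma spreadK R R' (X : 'M[k]_(tdim R, tdim R')) X' a :
  X *m X' = 1%:M -> preserves X -> preserves X' ->
  spread X a *m spread X' a = 1%:M.
Proof.
move=> XX' pX pX'; rewrite /spread; case: unlift => [v|] //.
set F := filt R v; set F' := filt R' v.
have FX : F *m X *m F' = F *m X by rewrite -preservesE.
have X'E : (1%:M - F') *m X' *m (1%:M - F) = X' *m (1%:M - F).
  by have /eqP := pX' v; rewrite -/F -/F' -mulmxA !mulmxBl !mul1mx mulmxA =>
    /eqP->; rewrite subr0.
have P1 : F *m X *m (F' *m X' *m F) = F.
  by rewrite !mulmxA FX -(mulmxA F) XX' mulmx1 filt_id.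
have P2 : F *m X *m (X' *m (1%:M - F)) = 0.
  by rewrite !mulmxA -(mulmxA F) XX' mulmx1 filt_compl.
have P3 : (1%:M - F) *m X *m (1%:M - F') *m (F' *m X' *m F) = 0.
  by rewrite !mulmxA -(mulmxA _ (1%:M - F')) compl_filt mulmx0 !mul0mx.
have P4 : (1%:M - F) *m X *m (1%:M - F') *m (X' *m (1%:M - F)) = 1%:M - F.
  rewrite -(mulmxA _ (1%:M - F')) (mulmxA (1%:M - F')) X'E mulmxA.
  by rewrite -(mulmxA _ X) XX' mulmx1 mulmxBr mulmx1 compl_filt subr0.
rewrite FX X'E [LHS]mulmxDl (mulmxDr (F *m X)) P1 P2.
by rewrite (mulmxDr (_ *m (1%:M - F'))) P3 P4 addr0 add0r addrC subrK.
Qed.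

(** Every identity block joins equal copies, hence equal diagonal blocks. The slot alone calls on
    the relation with [rep_mx] and on preservation. *)
Lemma spread_intertwines R R' (X : 'M[k]_(tdim R, tdim R')) E
   (x y : big_idx) :
  rep_mx R *m X = X *m rep_mx R' -> preserves X -> (E = sym_M) \/ (E = sym_N) ->
  sym_mx R (E x y) *m spread X y.2 = spread X x.2 *m sym_mx R' (E x y).
Proof.
have one (c : bool) : (c -> x.2 = y.2) -> sym_mx R (if c then One else Zero) *m
  spread X y.2 =
    spread X x.2 *m sym_mx R' (if c then One else Zero).
  by case: c => [->//|_] /=; rewrite ?mul1mx ?mulmx1 ?mul0mx ?mulmx0.
move=> AX pX [] ->; first by apply: one => /andP[_ /eqP].
rewrite /sym_N; case: ifP => _; last by apply: one => /and3P[_ _ /eqP].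
case: ifP => _; last by apply: one => /andP[/eqP-> /eqP->].
rewrite /sym_Z; case: eqP => [->|_]; last by rewrite /= mul0mx mulmx0.
rewrite {1}/spread unlift_none /spread; case: unlift => [v|] //=.
rewrite mulmxDl -(mulmxA _ (1%:M - _)) compl_filt mulmx0 addr0.
by rewrite -mulmxA filt_id -preservesE.
Qed.

Lemma blow_of_iso R R' : prep_iso R R' ->
  exists (S : 'M[k]_(bdim big_idx R, bdim big_idx R')) S', [/\ S *m S' = 1%:M,
    S' *m S = 1%:M,
  blow_mx sym_M R *m S = S *m blow_mx sym_M R' &
  blow_mx sym_N R *m S = S *m blow_mx sym_N R'].
Proof.
move=> [X] [X'] [XX' X'X AX pX pX'].
exists (key_diag (fun x : big_idx => spread X x.2)).
exists (key_diag (fun x : big_idx => spread X' x.2)).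
split.
- by apply: key_diagK => x; apply: spreadK.
- by apply: key_diagK => x; apply: spreadK.
- by apply: key_diag_intertwines => x y; apply: spread_intertwines => //; left.
- by apply: key_diag_intertwines => x y; apply: spread_intertwines => //; right.
Qed.

Lemma pair_contains : pair_contains_poset k le.
Proof.
exists (blow sym_M, blow sym_N); split.
  by split=> [||R]; [exact: blow_typed | exact: blow_typed | split].
move=> R R'; apply: (iff_trans (prep_redP R R')).
apply: (iff_trans _ (iff_sym (pair_redP _ _))) => /=.
(* The sizes agree by conversion, so [conform_mx] returns its argument and not the default [0]. *)
have eT R1 (E : big_idx -> big_idx -> bsym) :
    conform_mx 0 (bp_eval (blow E) R1) = blow_mx E R1 :> 'M_(bdim big_idx R1).
  exact: conform_mx_id.
split=> [/blow_of_iso [S] [S'] [SS' S'S SM SN]|[S] [S'] [SS' S'S SM SN]].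
  exists S, S'; split; [exact: SS' | exact: S'S | | ].
    by have := SM; rewrite -!eT.
  by have := SN; rewrite -!eT.
apply: (iso_of_blow SS' S'S); by rewrite -!eT.
Qed.

End Representation.

Theorem theorem3p2 (k : fieldType) (t : nat) (le : rel 'I_t) :
  reflexive le -> antisymmetric le -> transitive le ->
  pair_contains_poset k le.
Proof. by move=> le_refl le_anti le_trans; apply: pair_contains. Qed.
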